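(* Let $\mathcal{P}$ be one of the following properties of convex sets $K\subset\mathbb{R}^d$: (1) $K$ intersects $S$, where $S\subset\mathbb{R}^d$ is a fixed discrete set with $h(S)<\infty$; (2) $K$ contains at least $k$ points of the integer lattice $\mathbb{Z}^d$, where $k$ is a fixed positive integer; (3) $K$ contains at least $k$ points of a fixed set difference of lattices $\Lambda\setminus(L_1\cup\dots\cup L_n)$, where $k$ is a fixed positive integer, $\Lambda$ is a lattice in $\mathbb{R}^d$ and $L_1,\dots,L_n$ are finitely many sublattices of $\Lambda$. Then $\mathcal{P}$ is $h(\mathcal{P})$-colorable.
   Context: A property $\mathcal{P}$ is a function from the set of convex sets in $\mathbb{R}^d$ to $\{\text{true},\text{false}\}$. A lattice in $\mathbb{R}^d$ is a discrete additive subgroup of $\mathbb{R}^d$; a sublattice is a subgroup of a lattice. The Helly number $h(\mathcal{P})$ is the smallest positive integer $h$ such that for every $m\in\mathbb{N}$ and all convex sets $F_1,\dots,F_m\subset\mathbb{R}^d$: if $\mathcal{P}(F_{i_1}\cap\cdots\cap F_{i_h})$ is true for all $i_1,\dots,i_h\in\{1,\dots,m\}$, then $\mathcal{P}(F_1\cap\cdots\cap F_m)$ is true; $h(\mathcal{P}):=\infty$ if no such $h$ exists. For $S\subseteq\mathbb{R}^d$, $h(S)$ denotes $h(\mathcal{P})$ for the property ''$K$ intersects $S$''. It is known from Helly-type theorems in the literature that $h(\mathcal{P})$ is finite for the properties in (2) and (3). For a positive integer $N$, the property $\mathcal{P}$ is $N$-colorable if for all finite nonempty families $\mathcal{F}_1,\dots,\mathcal{F}_N$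 of closed convex sets in $\mathbb{R}^d$ (the color classes) such that $\mathcal{P}(K_1\cap\cdots\cap K_N)$ is true for every rainbow choice $K_1\in\mathcal{F}_1,\dots,K_N\in\mathcal{F}_N$, there is an index $i$ such that $\mathcal{P}(\bigcap\mathcal{F}_i)$ is true. *)

(* Defs.v *)
From HB Require Import structures.
From mathcomp Require Import all_boot all_order all_algebra.
From mathcomp Require Import all_classical all_reals all_analysis.

Set Implicit Arguments.
Unset Strict Implicit.
Unset Printing Implicit Defensive.

Import Order.TTheory GRing.Theory Num.Theory.
Import numFieldNormedType.Exports.

Local Open Scope classical_set_scope.
Local Open Scope ring_scope.

Section Helly.
Variables (R : realType) (d : nat).
Local Notation V := 'rV[R]_d.

(* A property of convex sets is a predicate [P : set V -> Prop]; the
   definitions below evaluate it on convex sets only. *)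

(* The family is nonempty: for [m = 0] the condition would read [P setT], so
   an unsatisfiable property would have no Helly number. *)
Definition helly_bound (P : set V -> Prop) (h : nat) : Prop :=
  forall (m : nat) (F : 'I_m -> set V), (0 < m)%N ->
    (forall i, convex_set (F i)) ->
    (forall i : 'I_h -> 'I_m, P (\bigcap_(j in [set: 'I_h]) F (i j))) ->
    P (\bigcap_(i in [set: 'I_m]) F i).

(* [None] stands for infinity. *)
Definition helly_number (P : set V -> Prop) : option nat :=
  if pselect (exists h, `[< (0 < h)%N /\ helly_bound P h >]) is left ex
  then Some (ex_minn ex) else None.

Definition colorable (P : set V -> Prop) (N : nat) : Prop :=
  forall F : 'I_N -> set (set V),
    (forall i, finite_set (F i) /\ F i !=set0) ->
    (forall i K, F i K -> closed K /\ convex_set K) ->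
    (forall K : 'I_N -> set V, (forall i, F i (K i)) ->
       P (\bigcap_(i in [set: 'I_N]) K i)) ->
    exists i, P (\bigcap_(K in F i) K).

(* There is no accumulation point anywhere in R^d, that is, every bounded set
   contains finitely many points of [S]; [{1/n | n >= 1}] is not discrete in
   this sense.  For subgroups of R^d this is the same as every point being
   isolated. *)
Definition discrete_set (S : set V) : Prop := limit_point S = set0.

Definition lattice (L : set V) : Prop := zmod_closed [in L] /\ discrete_set L.

Definition sublattice (L M : set V) : Prop := zmod_closed [in L] /\ L `<=` M.

Definition integer_lattice : set V := [set x | forall i, x ord0 i \is a Num.int].

Definition intersects (S : set V) : set V -> Prop := fun K => K `&` S !=set0.

Definition contains_at_least (k : nat) (T : set V) : set V -> Prop :=
  fun K => (`I_k #<= K `&` T)%card.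

End Helly.

Arguments integer_lattice : clear implicits.

(* Main.v *)
Require Import Defs.
From HB Require Import structures.
From mathcomp Require Import all_boot all_order all_algebra finmap.
From mathcomp Require Import all_classical all_reals all_analysis.
From mathcomp Require Import ring lra.

Set Implicit Arguments.
Unset Strict Implicit.
Unset Printing Implicit Defensive.

Import Order.TTheory GRing.Theory Num.Theory.
Import numFieldNormedType.Exports.

Local Open Scope classical_set_scope.
Local Open Scope ring_scope.

(** Two independent facts are combined: the last two properties have a finite
    Helly number, as the first has by hypothesis, and a finite Helly number [N]
    of a property of the form [contains_at_least k T] with [T] discrete forces
    [N]-colorability.  Meeting
    [S] is containing at least one point of [S], and the integer lattice is a
    lattice with nothing removed, so only this form of property occurs.

    Finiteness of the Helly number.  Suppose that all [h]-fold intersections of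
    a family contain [k] points of [T], but the whole intersection contains
    only a set [X] of fewer than [k] of them.  Then every [h]-fold intersection
    meets [T] minus [X] while the whole one does not.  So it is enough to bound
    the ordinary Helly number of [T] minus [X], uniformly in [X]
    ([helly_bound_count]).  When [T] is a lattice minus [n] sublattices,
    [T] minus [X] is a lattice minus at most [n + k] sets that are subgroups or
    single points.  A minimal non-intersecting subfamily yields a finite set of
    the same size which is independent: no point of the ground set lies in the
    hulls of all the sets [A] minus one point ([helly_bound_independent]).  An
    independent set can be exchanged for one of the same size whose hull
    contains no further point of the ground set ([independent_empty]).  If
    such a set is larger than the number of classes of the lattice modulo a
    suitable [m], two of its points [a], [b] are congruent modulo [m], and the
    lattice points dividing the segment from [a] to [b] into [m] equal parts
    must all be covered by the removed sets.  Choosing among them more points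
    than there are removed sets, at positions [j] such that all differences
    [j' - j] divide [j], two positions fall in the same removed set, which
    then contains [a] as well, a contradiction ([lattice_minus_independent]).

    Colorability.  This is the argument of Lovasz for the colorful Helly
    theorem, with the [k]-th highest point replacing the lowest one.  Only
    finitely many points of [T] matter, and some linear functional [f] separates
    them.  For every rainbow choice with one colour missing, slide the
    half-space [l <= f x] upwards until it contains exactly [k] points of the
    intersection of the choice, and let the choice [s] with missing colour [i0]
    have the smallest such [l].  For any set [K] of colour [i0], Helly's property
    applies to the half-space of [s], the sets of [s] and [K]: any [N] of
    these [N + 1] sets share [k] points, either because they form a rainbow
    choice or by minimality of [l].  Hence all of them share [k] points, which
    can only be the [k] points attached to [s].  These points lie in
    every set of colour [i0] ([colorable_indexed]). *)

(** * Convex hulls in row vectors *)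

Section Hull.
Variables (R : realType) (d : nat).
Local Notation V := 'rV[R]_d.
Implicit Types (A B C : set V) (a b x y z : V).

(** The weights of [convex_set] come bundled with their bounds; this form
    separates them. *)
Lemma convex_setP A : convex_set A <->
  forall x y (t : R), 0 <= t -> t <= 1 -> A x -> A y ->
    A (t *: x + (1 - t) *: y).
Proof.
split=> [cA x y t t0 t1 Ax Ay|cA x y l].
  have t01 : Itv.spec (@Itv.num_sem R) (Itv.Real `[0, 1]%Z) t.
    by apply/and3P; split=> //=; rewrite ?ger0_real// !bnd_simp.
  by have := cA x y (Itv.mk t01); rewrite !inE; apply.
by rewrite !inE => Ax Ay; apply: cA.
Qed.

Lemma convex_bigcap (I : Type) (D : set I) (F : I -> set V) :
  (forall i, D i -> convex_set (F i)) -> convex_set (\bigcap_(i in D) F i).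
Proof.
move=> cF; apply/convex_setP => x y t t0 t1 Fx Fy i Di.
by have /convex_setP := cF i Di; apply; [| |exact: Fx|exact: Fy].
Qed.

Lemma convex_setI A B : convex_set A -> convex_set B -> convex_set (A `&` B).
Proof.
move=> /convex_setP cA /convex_setP cB; apply/convex_setP.
by move=> x y t t0 t1 [Ax Bx] [Ay By]; split; [exact: cA|exact: cB].
Qed.

Lemma convex_set1 a : convex_set [set a].
Proof.
by apply/convex_setP => x y t _ _ -> ->; rewrite -scalerDl addrC subrK scale1r.
Qed.

Lemma convex_norm_le (r : R) : convex_set [set x : V | `|x| <= r].
Proof.
apply/convex_setP => x y t t0 t1 /= xr yr.
have -> : r = t * r + (1 - t) * r by ring.
apply: (le_trans (ler_normD _ _)); rewrite !normrZ !ger0_norm ?subr_ge0//.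
by apply: lerD; apply: ler_wpM2l; rewrite ?subr_ge0.
Qed.

Definition hull A := \bigcap_(C in [set C | convex_set C /\ A `<=` C]) C.

Lemma convex_hull A : convex_set (hull A).
Proof. by apply: convex_bigcap => C []. Qed.

Lemma sub_hull A : A `<=` hull A.
Proof. by move=> x Ax C [_]; apply. Qed.

Lemma hull_sub A C : convex_set C -> A `<=` C -> hull A `<=` C.
Proof. by move=> cC AC x; apply. Qed.

Lemma hullS A B : A `<=` B -> hull A `<=` hull B.
Proof.
by move=> AB; apply: hull_sub (subset_trans AB (@sub_hull B)); apply: convex_hull.
Qed.

(** The union of the segments from [a] to the points of [hull B] is itself
    convex. *)
Lemma hull_setU1 a B x : B !=set0 -> hull (a |` B) x ->
  exists y (t : R), [/\ hull B y, 0 <= t, t <= 1 & x = t *: a + (1 - t) *: y].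
Proof.
move=> [b Bb].
pose J := [set x | exists y (t : R),
  [/\ hull B y, 0 <= t, t <= 1 & x = t *: a + (1 - t) *: y]].
suff cJ : convex_set J.
  apply: (hull_sub cJ) => y [->|By].
    exists b, 1; split=> //; first exact: sub_hull.
    by rewrite scale1r subrr scale0r addr0.
  exists y, 0; split=> //; first exact: sub_hull.
  by rewrite scale0r add0r subr0 scale1r.
have /convex_setP cB := @convex_hull B.
apply/convex_setP => _ _ s s0 s1 [y1 [t1 [By1 t10 t11 ->]]]
  [y2 [t2 [By2 t20 t21 ->]]].
pose u := s * (1 - t1); pose v := (1 - s) * (1 - t2).
have u0 : 0 <= u by rewrite mulr_ge0// subr_ge0.
have v0 : 0 <= v by rewrite mulr_ge0// subr_ge0.
have uv1 : u + v <= 1 by rewrite /u /v; nra.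
have [uv0|uvN0] := eqVneq (u + v) 0.
  exists y1, 1; split=> //.
  have {}u0 : u = 0 by lra.
  have {}v0 : v = 0 by lra.
  apply/rowP => i; rewrite !mxE; move: u0 v0; rewrite /u /v => u0 v0.
  transitivity (s * a ord0 i - u * (a ord0 i - y1 ord0 i) + (1 - s) * a ord0 i
    - v * (a ord0 i - y2 ord0 i)); first by rewrite /u /v; ring.
  by rewrite /u /v u0 v0; ring.
have uv_gt0 : 0 < u + v by rewrite lt_neqAle eq_sym uvN0 addr_ge0.
(* normalizing the weights of [y1] and [y2] gives the point of [hull B] *)
exists ((u / (u + v)) *: y1 + (1 - u / (u + v)) *: y2), (1 - (u + v)).
split; [|lra|lra|].
  apply: cB => //; first by rewrite divr_ge0// addr_ge0.
  by rewrite ler_pdivrMr// mul1r lerDl.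
apply/rowP => i; rewrite !mxE /u /v; field.
by rewrite /u /v in uvN0.
Qed.

(** Otherwise [z] lies between [a] and a point [y] of [hull B], and [a] lies
    between [z] and a point [y'] of [hull B]; eliminating [z] puts [a] between
    [y] and [y'], hence in [hull B]. *)
Lemma hull_exchange B a z :
  ~ hull B a -> hull (a |` B) z -> z != a -> ~ hull (z |` B) a.
Proof.
move=> Ba; have [->|/set0P B0] := eqVneq B set0.
  rewrite setU0 => /(hull_sub (@convex_set1 a) (@subset_refl _ [set a])) ->.
  by rewrite eqxx.
move=> /(hull_setU1 B0) [y [t [By t0 t1 ze]]] za.
move=> /(hull_setU1 B0) [y' [s [By' s0 s1 ae]]]; apply: Ba.
have t_lt1 : t < 1.
  rewrite lt_neqAle t1 andbT; apply: contra_neq za => te.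
  by rewrite ze te subrr scale0r addr0 scale1r.
have N0 : 1 - s * t != 0.
  rewrite subr_eq0 eq_sym; apply/eqP => st1.
  have : s * t <= t by rewrite ler_piMl.
  by rewrite st1; lra.
have gt0 : 0 < 1 - s * t.
  by rewrite lt_neqAle eq_sym N0 subr_ge0 mulr_ile1.
have -> : a = (s * (1 - t) / (1 - s * t)) *: y +
              (1 - s * (1 - t) / (1 - s * t)) *: y'.
  apply/rowP => i; move: ae; rewrite ze => /rowP/(_ i); rewrite !mxE => ae.
  apply: (mulfI N0); transitivity (a ord0 i - s * t * a ord0 i); first by ring.
  by rewrite {1}ae; field.
have /convex_setP cB := @convex_hull B; apply: cB => //.
  by rewrite divr_ge0 ?mulr_ge0 ?subr_ge0 ?mulr_ile1.
by rewrite ler_pdivrMr// mul1r; nra.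
Qed.

End Hull.

(** * Bounded parts of discrete sets *)

Section Discrete.
Variables (R : realType) (d : nat).
Local Notation V := 'rV[R]_d.

Lemma closed_norm_le (r : R) : closed [set x : V | `|x| <= r].
Proof.
have -> : [set x : V | `|x| <= r] = (fun x : V => `|x|) @^-1` [set y | y <= r].
  by [].
by apply: preimage_closed => [x _|]; [exact: norm_continuous|exact: closed_le].
Qed.

(** The ball is compact, and each of its points has an open neighbourhood with
    at most one point of [S], since a point without such a neighbourhood would
    be a limit point. *)
Lemma discrete_finite_ball (S : set V) (r : R) :
  discrete_set S -> finite_set (S `&` [set x | `|x| <= r]).
Proof.
move=> dS.
have cB : compact [set x : V | `|x| <= r].
  apply: bounded_closed_compact; last exact: closed_norm_le.
  exists r; split; first exact: num_real.
  by move=> M rM x /= xr; rewrite (le_trans xr)// ltW.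
have /choice [U HU] : forall x : V, exists U, open_nbhs x U /\ S `&` U `<=` [set x].
  move=> x; apply: contrapT => nU.
  have : limit_point S x.
    move=> W; rewrite nbhsE => -[U Ux UW].
    apply: contrapT => nW; apply: nU; exists U; split=> // y [Sy Uy].
    apply: contrapT => /eqP yx; apply: nW; exists y; split=> //.
    exact: UW.
  by rewrite dS.
rewrite compact_cover in cB.
have [|x _|D _ DB] := cB V [set: V] U.
- by move=> x _; case: (HU x) => -[].
- by exists x => //; have [[]] := HU x.
apply: (@sub_finite_set _ _ [set` D]); last exact: finite_fset.
move=> x [Sx xr]; have [y Dy Uy] := DB x xr.
by have [_ /(_ x)] := HU y => -> //.
Qed.

End Discrete.

(** * Independent sets and empty polytopes *)

Section HellyIndependent.
Variables (R : realType) (d : nat).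
Local Notation V := 'rV[R]_d.
Local Notation hullf A := (hull [set` A]).

Lemma fset_card_lt (A B : {fset V}) a :
  {subset A <= B} -> a \in B -> a \notin A -> (#|` A| < #|` B|)%N.
Proof.
move=> AB aB aA; apply: fproper_ltn_card; rewrite fproperE.
by apply/andP; split; [apply/fsubsetP|apply/fsubsetPn; exists a].
Qed.

(** When moreover [A] lies in [T], the sets [hull (A `\ a)] have no common point
    in [T] although any [#|` A| - 1] of them do: such families are the extreme
    examples for the Helly number of intersecting [T]. *)
Definition independent (T : set V) (A : {fset V}) : Prop :=
  forall w, T w -> exists2 a, a \in A & ~ hullf (A `\ a)%fset w.

Definition separators (A : {fset V}) (z : V) : {fset V} :=
  [fset a in A | `[< ~ hullf (A `\ a)%fset z >]]%fset.

Lemma mem_separators A z a : reflect (a \in A /\ ~ hullf (A `\ a)%fset z)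
  (a \in separators A z).
Proof. by rewrite !inE; apply: (iffP andP) => -[aA /asboolP]. Qed.

(** A finite set is contained in a ball. *)
Lemma fset_hull_finite (T : set V) (A : {fset V}) :
  discrete_set T -> finite_set (hullf A `&` T).
Proof.
move=> dT; pose r := \sum_(a <- A) `|a|.
apply: sub_finite_set (discrete_finite_ball r dT) => x [Ax Tx]; split=> //.
apply: (hull_sub (@convex_norm_le _ _ r)) Ax => a /= aA.
by rewrite /r (big_fsetD1 a)//= lerDl sumr_ge0.
Qed.

Lemma independent_extreme (T : set V) (A : {fset V}) a :
  [set` A] `<=` T -> independent T A -> a \in A -> ~ hullf (A `\ a)%fset a.
Proof.
move=> AT indA aA ha; have [b bA nb] := indA a (AT _ aA).
have [ab|ab] := eqVneq a b; first by rewrite -ab in nb.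
by apply: nb; apply: sub_hull; rewrite /= !inE ab aA.
Qed.

(** While [hull A] contains a further point of [T], pick such a point [z] with
    the fewest separators and exchange it for one of its separators [a].  The
    hull shrinks, since it loses [a].  The new set is still independent: a point
    [w] of [T] violating this would be another further point, all separators of
    which are separators of [z] other than [a]. *)
Lemma independent_empty (T : set V) (A : {fset V}) :
  discrete_set T -> [set` A] `<=` T -> independent T A ->
  exists B : {fset V}, [/\ #|` B| = #|` A|, [set` B] `<=` T, independent T B &
    hullf B `&` T `<=` [set` B]].
Proof.
move=> dT.
have [n] := ubnP #|` fset_set (hullf A `&` T)|.
elim: n A => // n IHn A; rewrite ltnS => leAn AT indA.
have finA := fset_hull_finite A dT.
have [|/existsNP [z0 /not_implyP [[Az0 Tz0] /= z0A]]] :=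
  pselect (hullf A `&` T `<=` [set` A]); first by exists A.
have extA := independent_extreme AT indA.
(* the least number of separators of a further point *)
have exk : exists k, `[< exists z, [/\ hullf A z, T z, z \notin A &
    #|` separators A z| = k] >].
  exists #|` separators A z0|; apply/asboolP; exists z0; split=> //.
  exact/negP.
case: (ex_minnP exk) => k /asboolP [z [Az Tz zA zk]] mink.
have [a aA naz] := indA z Tz.
pose B := (z |` (A `\ a))%fset.
have za : z != a by apply: contraNneq zA => ->.
have zAa : z \notin (A `\ a)%fset by rewrite !inE (negPf zA) andbF.
have cardB : #|` B| = #|` A| by rewrite cardfsU1 zAa (cardfsD1 a A) aA.
have BT : [set` B] `<=` T.
  by move=> x; rewrite /= !inE => /predU1P[->//|/andP[_]]; apply: AT.
have AE b : b \in A -> [set` A] = b |` [set` (A `\ b)%fset].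
  by move=> bA; rewrite -set_fsetU1 fsetD1K.
have BE : [set` B] = z |` [set` (A `\ a)%fset] by exact: set_fsetU1.
have nBa : ~ hullf B a.
  rewrite BE; apply: hull_exchange => //; first exact: extA.
  by rewrite -AE.
have hBA : hullf B `<=` hullf A.
  apply: hull_sub; first exact: convex_hull.
  move=> x; rewrite /= !inE => /predU1P[->//|/andP[_ xA]].
  exact: sub_hull.
have [indB|] := pselect (independent T B).
  rewrite -cardB; apply: IHn => //; apply: leq_trans leAn.
  have finB := fset_hull_finite B dT.
  apply: (@fset_card_lt _ _ a) => [x||]; rewrite !in_fset_set//.
  - by rewrite !inE => -[/hBA].
  - by rewrite inE; split; [exact: sub_hull|exact: AT].
  - by apply/negP; rewrite inE => -[].
case/existsNP => w /not_implyP [Tw] nw; exfalso.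
have {}nw b : b \in B -> hullf (B `\ b)%fset w.
  by move=> bB; apply: contrapT => nb; apply: nw; exists b.
have Aaw : hullf (A `\ a)%fset w.
  have := nw z (fset1U1 _ _); apply: hullS => x /=.
  by rewrite !inE; case: eqVneq.
have Bb b : b \in A -> b != a ->
    hull (z |` [set` (A `\ b)%fset]) w.
  move=> bA ba; have := nw b; rewrite !inE ba bA orbT => /(_ isT).
  apply: hullS => x /=; rewrite !inE => /andP[xb /predU1P[->|/andP[_ xA]]].
    by left.
  by right; rewrite xb.
have Aw : hullf A w.
  by apply: hullS Aaw => x /=; rewrite !inE => /andP[].
have wA : w \notin A.
  apply/negP => wA.
  have wa : w != a by apply/eqP => wa; apply: (extA a aA); rewrite -{2}wa.
  have zw : z != w by apply: contraNneq zA => ->.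
  have Azw : hull (w |` [set` (A `\ w)%fset]) z by rewrite -AE.
  exact: (hull_exchange (extA w wA) Azw zw (Bb w wA wa)).
have : (k <= #|` separators A w|)%N.
  by apply: mink; apply/asboolP; exists w.
apply/negP; rewrite -ltnNge -zk.
apply: (@fset_card_lt _ _ a) => [b||].
- move=> /mem_separators [bA nb]; apply/mem_separators; split; first exact: bA.
  move=> Abz; have ba : b != a.
    by apply/eqP => ba; apply: nb; rewrite ba; exact: Aaw.
  apply: nb; apply: hull_sub (Bb b bA ba); first exact: convex_hull.
  by move=> x [->//|]; apply: sub_hull.
- exact/mem_separators.
- by apply/negP => /mem_separators [_].
Qed.

End HellyIndependent.

(** * Lattices and removed progressions *)

Section LatticeHelly.
Variables (R : realType) (d : nat).
Local Notation V := 'rV[R]_d.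

Lemma zmod_closedP (L : set V) : zmod_closed [in L] ->
  L 0 /\ forall x y, L x -> L y -> L (x - y).
Proof.
move=> [L0 LB]; split=> [|x y Lx Ly]; first by move: L0; rewrite inE.
by have := LB x y; rewrite !inE; apply.
Qed.

Lemma zmod_closedN (L : set V) x : zmod_closed [in L] -> L x -> L (- x).
Proof. by move=> /zmod_closedP [L0 LB] Lx; rewrite -sub0r; apply: LB. Qed.

Lemma zmod_closedD (L : set V) x y : zmod_closed [in L] -> L x -> L y -> L (x + y).
Proof.
move=> zL Lx Ly; rewrite -[y]opprK; apply: (zmod_closedP zL).2 => //.
exact: zmod_closedN.
Qed.

Lemma zmod_closedMn (L : set V) x n : zmod_closed [in L] -> L x -> L (x *+ n).
Proof.
move=> zL Lx; elim: n => [|n IHn]; first exact: (zmod_closedP zL).1.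
by rewrite mulrS; apply: zmod_closedD.
Qed.

Lemma zmod_closedMz (L : set V) x (n : int) :
  zmod_closed [in L] -> L x -> L (x *~ n).
Proof.
move=> zL Lx; case: n => n; first exact: zmod_closedMn.
by rewrite NegzE mulrNz; apply: zmod_closedN => //; apply: zmod_closedMn.
Qed.

Lemma zmod_closed_sum (L : set V) (I : Type) (r : seq I) (F : I -> V) :
  zmod_closed [in L] -> (forall i, L (F i)) -> L (\sum_(i <- r) F i).
Proof.
move=> zL LF; elim/big_ind: _ => //; first exact: (zmod_closedP zL).1.
by move=> x y; apply: zmod_closedD.
Qed.

(** Take a maximal linearly independent family [X] in [L]; it spans [L].
    Subtracting from [x] the [m]-fold of a combination of [X] with integer
    coefficients leaves a point with coordinates in the interval from [0] to
    [m], and there are only finitely many such points of [L]. *)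
Lemma lattice_residues (L : set V) (m : nat) : lattice L -> (0 < m)%N ->
  exists Q : {fset V}, forall x, L x ->
    exists2 r, r \in Q & exists2 c, L c & x = r + c *+ m.
Proof.
move=> [zL dL] m0.
pose isfree k := `[< exists X : k.-tuple V, free X /\ forall i, L X`_i >].
have ex0 : exists k, isfree k.
  exists 0%N; apply/asboolP; exists [tuple]; split; first exact: nil_free.
  by move=> i; rewrite nth_nil; exact: (zmod_closedP zL).1.
have bound k : isfree k -> (k <= d)%N.
  move=> /asboolP [X [fX _]]; move: fX; rewrite /free => /eqP.
  rewrite size_tuple => <-; have := dimvS (subvf <<X>>).
  by rewrite dimvf /dim /= mul1n.
case: (ex_maxnP ex0 bound) => k /asboolP [X [fX LX]] maxk.
have spanX x : L x -> x \in <<X>>%VS.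
  move=> Lx; apply: contraT => nx.
  suff : (k.+1 <= k)%N by rewrite ltnn.
  apply: maxk; apply/asboolP; exists [tuple of x :: X]; split.
    by rewrite free_cons nx.
  by case.
pose r : R := \sum_(i < k) `|X`_i| *+ m.
have finQ := discrete_finite_ball r dL.
exists (fset_set (L `&` [set x | `|x| <= r])) => x Lx.
pose t i := coord X i x / m%:R.
pose c := \sum_(i < k) X`_i *~ Num.floor (t i).
have Lc : L c by apply: zmod_closed_sum => // i; apply: zmod_closedMz.
exists (x - c *+ m); last by exists c => //; rewrite subrK.
rewrite in_fset_set// inE; split.
  by apply: (zmod_closedP zL).2 => //; apply: zmod_closedMn.
rewrite /= [in X in `|X|](coord_span (spanX x Lx)) /c -sumrMnl -sumrB.
apply: le_trans (ler_norm_sum _ _ _) _; apply: ler_sum => i _.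
have m_gt0 : (0 : R) < m%:R by rewrite ltr0n.
have -> : coord X i x *: X`_i - X`_i *~ Num.floor (t i) *+ m =
          ((t i - (Num.floor (t i))%:~R) * m%:R) *: X`_i.
  rewrite mulrBl scalerBl /t divfK ?gt_eqF//; congr (_ - _).
  by rewrite -scaler_int -scaler_nat scalerA mulrC.
rewrite normrZ -[leRHS]mulr_natl; apply: ler_wpM2r => //.
rewrite normrM (ger0_norm (ltW m_gt0)) ler_piMl// ?ltW//.
have := floor_itv (t i); rewrite intrD1 => /andP[t_ge t_lt].
by rewrite ger0_norm; lra.
Qed.

(** Two points of [C] force the points that continue their difference
    backwards to lie in [C].  This covers subgroups and single points alike. *)
Definition progression_closed (C : set V) : Prop :=
  forall x y (q : nat), C x -> C (x + y) -> C (x - y *+ q).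

Lemma zmod_progression (L : set V) : zmod_closed [in L] -> progression_closed L.
Proof.
move=> zL x y q Lx Lxy; apply: (zmod_closedP zL).2 => //.
apply: zmod_closedMn => //; rewrite -[y](addKr x) addrC.
exact: (zmod_closedP zL).2.
Qed.

Lemma set1_progression (c : V) : progression_closed [set c].
Proof.
move=> x y q /= -> /eqP; rewrite -subr_eq0 addrC addKr => /eqP ->.
by rewrite mul0rn subr0.
Qed.

(** If [s] is such a set and [P] is the product of its elements, then [P]
    together with the translate of [s] by [P] is one with one more element. *)
Lemma divisible_differences (n : nat) : exists s : seq nat,
  [/\ size s = n, all (leq 1) s, uniq s &
    forall i j, i \in s -> j \in s -> (i < j)%N -> (j - i %| i)%N].
Proof.
elim: n => [|n [s [sz pos us div]]]; first by exists [::].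
pose P := (\prod_(i <- s) i)%N.
have P0 : (0 < P)%N.
  by rewrite /P big_seq; apply: prodn_cond_gt0 => i; apply: (allP pos).
have dvdP i : i \in s -> (i %| P)%N.
  by move=> si; rewrite /P (big_rem i)//= dvdn_mulr.
exists (P :: [seq P + i | i <- s])%N; split.
- by rewrite /= size_map sz.
- rewrite /= P0; apply/allP => _ /mapP [i _ ->].
  by rewrite addn_gt0 P0.
- rewrite /= map_inj_uniq ?us ?andbT; last exact: addnI.
  apply/mapP => -[i /(allP pos) i0 /eqP]; rewrite -[X in X == _]addn0 eqn_add2l.
  by move=> /eqP i00; rewrite -i00 in i0.
- move=> i j; rewrite !inE => /predU1P[->|/mapP[i' si' ->]].
    move=> /predU1P[->|/mapP[j' sj' ->]]; first by rewrite ltnn.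
    by rewrite addKn => _; apply: dvdP.
  move=> /predU1P[->|/mapP[j' sj' ->]]; first by rewrite ltnNge leq_addr.
  rewrite ltn_add2l subnDl => ij; apply: dvdn_add (div _ _ si' sj' ij).
  by have := dvdP _ si'; apply: dvdn_trans; apply: div.
Qed.

End LatticeHelly.

(** * Finiteness of Helly numbers *)

Section CountHelly.
Variables (R : realType) (d : nat).
Local Notation V := 'rV[R]_d.

Lemma pigeonhole (U W : eqType) (f : U -> W) (s : seq U) (t : seq W) :
  uniq s -> {subset map f s <= t} -> (size t < size s)%N ->
  exists x y, [/\ x \in s, y \in s, x != y & f x = f y].
Proof.
move=> us st; rewrite ltnNge; apply: contraNP => nxy.
rewrite -(size_map f s); apply: uniq_leq_size => //.
rewrite map_inj_in_uniq// => x y xs ys fxy; apply: contrapT => /eqP xy.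
by apply: nxy; exists x, y.
Qed.

Lemma card_le_fsetP (T : choiceType) (k : nat) (A : set T) :
  (`I_k #<= A)%card <-> exists2 X : {fset T}, [set` X] `<=` A & (k <= #|` X|)%N.
Proof.
split=> [kA|[X XA kX]].
  have [finA|infA] := pselect (finite_set A); last exact: infinite_set_fset.
  exists (fset_set A); last exact: leq_card_fset_set.
  by rewrite fset_setK.
apply: card_le_trans (subset_card_le XA).
have /card_eq_fsetP := erefl #|` X|.
by move=> /card_eqPle[_]; apply: card_le_trans; rewrite card_le_II.
Qed.

Lemma contains_at_leastS k (T K K' : set V) : K `<=` K' ->
  contains_at_least k T K -> contains_at_least k T K'.
Proof. 
move=> KK' kK; apply: card_le_trans kK (subset_card_le _).
exact: setSI.
 Qed.

(** In a subfamily minimal with empty intersection in [T], each member [F i]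
    misses a point [a i] of [T] common to all others.  These points are
    independent, as [F i] contains the hull of all of them but [a i]. *)
Lemma helly_bound_independent (T : set V) (h : nat) :
  (forall A : {fset V}, [set` A] `<=` T -> independent T A -> (#|` A| <= h)%N) ->
  helly_bound (intersects T) h.
Proof.
move=> indh m F m_gt0 cF hF; apply: contrapT => nF.
pose missed (J : {set 'I_m}) :=
  `[< forall w, T w -> exists2 i, i \in J & ~ F i w >].
have missedT : missed [set: 'I_m]%SET.
  apply/asboolP => w Tw; apply: contrapT => nw; apply: nF; exists w; split=> //.
  by move=> i _; apply: contrapT => nFw; apply: nw; exists i; rewrite ?inE.
have [J /minsetP[/asboolP Jmiss Jmin] _] := minset_exists missedT.
have /choice [a aP] : forall i, exists w, i \in J ->
    T w /\ forall j, j \in J -> j != i -> F j w.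
  move=> i; have [iJ|] := boolP (i \in J); last by exists 0.
  have /asboolPn/existsNP[w /not_implyP[Tw nw]] : ~~ missed (J :\ i)%SET.
    apply/negP => /Jmin /(_ (subD1set _ _)) JE.
    by move: iJ; rewrite -JE !inE eqxx.
  exists w => _; split=> //.
  move=> j jJ ji; apply: contrapT => nFw; apply: nw; exists j => //.
  by rewrite !inE ji.
have aNF i : i \in J -> ~ F i (a i).
  move=> iJ Fia; have [Ta Fa] := aP i iJ; have [j jJ] := Jmiss _ Ta.
  by apply; have [->//|ji] := eqVneq j i; apply: Fa.
have a_inj : {in J &, injective a}.
  move=> i j iJ jJ aij; apply/eqP/negPn/negP => ij.
  by apply: (aNF i iJ); rewrite aij; apply: (aP j jJ).2.
pose A := [fset a i | i in J]%fset.
have cardA : #|` A| = #|J|.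
  by rewrite /A card_in_imfset//= cardE.
have AP x : x \in A -> exists2 i, i \in J & x = a i.
  by move=> /imfsetP[i /= iJ ->]; exists i.
have Jh : (#|J| <= h)%N.
  rewrite -cardA; apply: indh => [x /AP[i iJ ->]|w Tw]; first exact: (aP i iJ).1.
  have [i iJ nFi] := Jmiss w Tw; exists (a i); first exact: in_imfset.
  move=> Aw; apply: nFi; apply: hull_sub Aw => // x /=; rewrite !inE => /andP[xa].
  move=> /AP[j jJ xE]; rewrite xE in xa *; apply: (aP j jJ).2 => //.
  by apply: contraNneq xa => ->.
pose e (l : 'I_h) := nth (Ordinal m_gt0) (enum J) l.
have [w [Fw Tw]] := hF e; have [j jJ] := Jmiss w Tw; apply.
have jlt : (index j (enum J) < h)%N.
  by apply: leq_trans Jh; rewrite cardE index_mem mem_enum.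
have := Fw (Ordinal jlt) I.
by rewrite /e /= nth_index// mem_enum.
Qed.

(** An empty polytope with vertices in [L] minus the sets [C i] cannot have two
    vertices [a] and [b = a + e *+ m] with [e] in [L].  The points [a + e *+ j]
    with [0 < j < m] are not vertices, so each lies in some [C i].  By
    pigeonhole, some [C i] contains two of them, at positions [j < j'] from
    [divisible_differences].  As [j' - j] divides [j], stepping backwards by
    [j' - j] ends exactly at [a], so that [a] belongs to [C i]. *)
Lemma lattice_minus_independent (L : set V) (N : nat) : lattice L ->
  exists q, forall (I : finType) (C : I -> set V), (#|I| <= N)%N ->
    (forall i, progression_closed (C i)) ->
  forall A : {fset V}, let T := L `\` \bigcup_(i in [set: I]) C i in
    [set` A] `<=` T -> independent T A -> (#|` A| <= q)%N.
Proof.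
move=> latL; have [zL dL] := latL.
have [s [sz pos us div]] := divisible_differences N.+1.
(* any modulus above all elements of [s] will do *)
pose m := (\sum_(j <- s) j).+1.
have s_lt j : j \in s -> (j < m)%N.
  by move=> js; rewrite ltnS (big_rem j)//= leq_addr.
have [Q QP] := lattice_residues latL (ltn0Sn (\sum_(j <- s) j)).
exists #|` Q| => I C IN Cp A T AT indA.
have dT : discrete_set T.
  apply/seteqP; split=> // x Tx; rewrite -dL => U /Tx [y [yx [Ly _] Uy]].
  by exists y.
have [B [<- BT indB BE]] := independent_empty dT AT indA.
have extB := independent_extreme BT indB.
rewrite leqNgt; apply/negP => QB.
have /choice [r rP] : forall x, exists r, L x ->
    r \in Q /\ exists2 c, L c & x = r + c *+ m.
  move=> x; have [Lx|nLx] := pselect (L x); last by exists 0.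
  by have [r rQ [c Lc xE]] := QP x Lx; exists r => _; split=> //; exists c.
have BL x : x \in B -> L x by move=> /BT[].
have [a [b [aB bB ab rab]]] : exists a b, [/\ a \in B, b \in B, a != b & r a = r b].
  apply: (pigeonhole (t := enum_fset Q) (fset_uniq B)) => //.
  by move=> _ /mapP[x xB ->]; apply: (rP x (BL x xB)).1.
have [_ [c Lc aE]] := rP a (BL a aB).
have [_ [c' Lc' bE]] := rP b (BL b bB).
pose e := c' - c.
have Le : L e by apply: (zmod_closedP zL).2.
have bE' : b = a + e *+ m.
  by rewrite bE aE rab /e mulrnBl addrC -!addrA [c *+ m + _]addrC subrK addrC.
have e0 : e != 0.
  by apply: contraNneq ab => e0; rewrite bE' e0 mul0rn addr0.
have enK n n' : e *+ n = e *+ n' -> n = n'.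
  rewrite -(scaler_nat n e) -(scaler_nat n' e) => /eqP.
  rewrite -subr_eq0 -scalerBl scaler_eq0 (negPf e0).
  by rewrite orbF subr_eq0 eqr_nat => /eqP.
pose p j := a + e *+ j.
have pC j : j \in s -> exists i, C i (p j).
  move=> js; apply: contrapT => nC.
  have j_gt0 : (0 < j)%N by apply: (allP pos).
  have Tp : T (p j).
    split; first by apply: zmod_closedD (BL a aB) _ => //; apply: zmod_closedMn.
    by move=> [i _ Ci]; apply: nC; exists i.
  have m_gt0 : (0 : R) < m%:R by rewrite ltr0n.
  have pE : p j = (1 - j%:R / m%:R) *: a + (1 - (1 - j%:R / m%:R)) *: b.
    rewrite bE' /p -(scaler_nat m e) -(scaler_nat j e).
    apply/rowP => l; rewrite !mxE; field.
    by rewrite gt_eqF.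
  have hullp (D : {fset V}) : a \in D -> b \in D -> hull [set` D] (p j).
    move=> aD bD; rewrite pE.
    have /convex_setP := @convex_hull _ _ [set` D]; apply; try exact: sub_hull.
      by rewrite subr_ge0 ler_pdivrMr// mul1r ler_nat ltnW// s_lt.
    by rewrite gerBl divr_ge0.
  have pB : p j \in B by apply: BE; split=> //; apply: hullp.
  apply: (extB _ pB); apply: hullp; rewrite !inE ?aB ?bB andbT.
    rewrite eq_sym -subr_eq0 /p addrC addKr -[0](mulr0n e).
    by apply/eqP => /enK j0; rewrite j0 in j_gt0.
  rewrite bE'; apply/eqP => /addrI/enK jm.
  by have := s_lt j js; rewrite -jm ltnn.
pose f j := [pick i | `[< C i (p j) >]].
have fP j : j \in s -> exists2 i, f j = Some i & C i (p j).
  move=> js; rewrite /f; case: pickP => [i /asboolP Ci|nC]; first by exists i.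
  by have [i Ci] := pC j js; have /asboolP := nC i.
have [j [j' [js js' jj' fjj']]] : exists j j',
    [/\ j \in s, j' \in s, j != j' & f j = f j'].
  apply: (@pigeonhole _ _ f s [seq Some i | i <- enum I]) => //.
    by move=> _ /mapP[j /fP[i -> _] ->]; apply: map_f; rewrite mem_enum.
  by rewrite size_map -cardE sz ltnS.
wlog lt_jj' : j j' js js' jj' fjj' / (j < j')%N => [hw|].
  have [|lt] := ltnP j j'; first exact: hw.
  by apply: (hw j' j) => //; rewrite 1?eq_sym// ltn_neqAle eq_sym jj'.
have [i fi Ci] := fP j js; have [i' fi' Ci'] := fP j' js'.
have ii' : i' = i by apply: Some_inj; rewrite -fi -fi' fjj'.
rewrite ii' in Ci'.
have /dvdnP[q jE] := div j j' js js' lt_jj'.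
have pj' : p j' = p j + e *+ (j' - j).
  by rewrite /p -addrA -mulrnDr subnKC// ltnW.
rewrite pj' in Ci'; have := Cp i _ _ q Ci Ci'.
rewrite -mulrnA mulnC -jE /p addrK => Ca.
by have [_] := BT a aB; apply; exists i.
Qed.

(** The at most [k - 1] points of [T] common to the whole family can be removed
    from [T]: each [h]-fold intersection keeps one of its [k] points. *)
Lemma helly_bound_count (T : set V) (k h : nat) :
  (forall X : {fset V}, (#|` X| < k)%N ->
    helly_bound (intersects (T `\` [set` X])) h) ->
  helly_bound (contains_at_least k T) h.
Proof.
move=> hX m F m_gt0 cF hF; apply: contrapT => nF.
set K := \bigcap_(i in _) F i in nF.
have finK : finite_set (K `&` T).
  by apply: contrapT => infK; apply: nF; apply/card_le_fsetP/infinite_set_fset.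
have ltX : (#|` fset_set (K `&` T)| < k)%N.
  rewrite ltnNge; apply/negP => kX; apply: nF; apply/card_le_fsetP.
  by exists (fset_set (K `&` T)) => //; rewrite fset_setK.
have [|w [Kw [Tw]]] := hX _ ltX m F m_gt0 cF.
  move=> i; have /card_le_fsetP [Y YF kY] := hF i.
  have /fsubsetPn [y yY yX] : ~~ (Y `<=` fset_set (K `&` T))%fset.
    by apply/negP => /fsubset_leq_card; rewrite leqNgt (leq_trans ltX kY).
  by exists y; have [Fy Ty] := YF y yY; split=> //; split=> //; apply/negP.
by apply; rewrite /= in_fset_set// inE.
Qed.

Lemma helly_bound_lattice_minus (L : set V) (n : nat) (M : 'I_n -> set V) (k : nat) :
  lattice L -> (forall i, zmod_closed [in M i]) ->
  exists2 h, (0 < h)%N &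
    helly_bound (contains_at_least k (L `\` \bigcup_(i in [set: 'I_n]) M i)) h.
Proof.
move=> latL zM; have [q qP] := lattice_minus_independent (n + k) latL.
exists q.+1 => //; apply: helly_bound_count => X ltX.
apply: helly_bound_independent => A AT indA; apply: leqW.
pose C (i : 'I_n + X) := match i with inl i => M i | inr x => [set val x] end.
have TE : (L `\` \bigcup_(i in [set: 'I_n]) M i) `\` [set` X] =
    L `\` \bigcup_(i in setT) C i.
  rewrite setDDl; apply/seteqP; split=> x [Lx nx]; split=> //.
    by move=> [[i|y] _ Cx]; apply: nx; [left; exists i|right; rewrite Cx /=].
  move=> [[i _ Mx]|Xx]; apply: nx; first by exists (inl i).
  by exists (inr [` Xx]%fset).
rewrite TE in AT indA; apply: qP AT indA.
  by rewrite card_sum card_ord -cardfE leq_add2l ltnW.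
by case=> [i|x]; [exact: (zmod_progression (zM i))|exact: set1_progression].
Qed.

Lemma helly_numberP (P : set V -> Prop) (h : nat) :
  (0 < h)%N -> helly_bound P h ->
  exists N, [/\ helly_number P = Some N, (0 < N)%N & helly_bound P N].
Proof.
move=> h_gt0 hP; rewrite /helly_number; case: pselect => [ex|nex].
  by case: ex_minnP => N /asboolP [N0 hN] _; exists N.
by exfalso; apply: nex; exists h; apply/asboolP.
Qed.

End CountHelly.

(** * The colorful theorem *)

Section Colorful.
Variables (R : realType) (d : nat).
Local Notation V := 'rV[R]_d.

(** Evaluation at [t] of the polynomial with coefficients [x] is linear in [x],
    and it is injective on [Z] unless [t] is a root of one of finitely many
    nonzero polynomials. *)
Lemma exists_generic_functional (Z : {fset V}) : exists f : V -> R,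
  [/\ forall l, convex_set [set x | l <= f x] & {in Z &, injective f}].
Proof.
pose D := [seq rVpoly (xy.1 - xy.2) |
             xy <- [seq xy <- [seq (x, y) | x <- Z, y <- Z] | xy.1 != xy.2]].
pose p : {poly R} := \prod_(g <- D) g.
have p0 : p != 0.
  rewrite prodf_seq_neq0; apply/allP => _ /mapP[[x y] + ->].
  rewrite mem_filter /= => /andP[xy _]; apply: contra_neq xy => /eqP.
  rewrite linearB subr_eq0 => /eqP /(congr1 (@poly_rV R d)).
  by rewrite !rVpolyK.
have [t nt] : exists t, ~~ root p t.
  apply: contrapT => nt.
  have := @max_poly_roots _ p [seq i%:R | i <- iota 0 (size p)] p0.
  rewrite size_map size_iota ltnn => contra; apply/notF/contra.
    by apply/allP => u _; apply: contraT => nu; case: nt; exists u.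
  rewrite map_inj_uniq ?iota_uniq// => i j /eqP.
  by rewrite eqr_nat => /eqP.
exists (fun x => (rVpoly x).[t]); split=> [l|x y xZ yZ fxy].
  apply/convex_setP => x y s s0 s1 /= lx ly.
  rewrite linearD !linearZ /= hornerD !hornerZ; nra.
apply: contraNeq nt => xy.
have xyD : rVpoly (x - y) \in D.
  apply/mapP; exists (x, y) => //; rewrite mem_filter /= xy.
  by apply/allpairsP; exists (x, y).
rewrite /p (big_rem _ xyD) /= rootM rootE linearB /= hornerD hornerN fxy.
by rewrite subrr eqxx.
Qed.

(** Removing the lowest point of [X] does not change the number of points above
    any other one. *)
Lemma kth_largest (f : V -> R) (X : {fset V}) (k : nat) :
  {in X &, injective f} -> (0 < k <= #|` X|)%N ->
  exists2 x, x \in X & #|` [fset y in X | f x <= f y]%fset| = k.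
Proof.
move=> f_inj /andP[k_gt0].
have [n cardX] : {n | #|` X| = n} by exists #|` X|.
elim: n X cardX f_inj => [|n IHn] X cardX f_inj; rewrite cardX.
  by rewrite leqn0 => /eqP k0; rewrite k0 in k_gt0.
have /fset0Pn [x0 x0X] : X != fset0 by rewrite -cardfs_gt0 cardX.
have [x xX xmin] : exists2 x, x \in X & forall y, y \in X -> f x <= f y.
  have [x _ xmin] := @Order.TotalTheory.arg_minP _ R X [` x0X]%fset predT
    (fun x => f (val x)) isT.
  by exists (val x) => [|y yX]; [exact: valP|exact: (xmin [` yX]%fset)].
rewrite leq_eqVlt => /predU1P[->|].
  exists x => //; rewrite -cardX; congr (#|` _|); apply/fsetP => y.
  by rewrite !inE /=; case: (boolP (y \in X)) => //= /xmin ->.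
rewrite ltnS => kn.
have cardXx : #|` (X `\ x)%fset| = n.
  by move: cardX; rewrite (cardfsD1 x X) xX => -[].
have [||z] := IHn _ cardXx.
- by move=> y z; rewrite !inE => /andP[_ yX] /andP[_ zX]; apply: f_inj.
- by rewrite cardXx.
rewrite !inE => /andP[zx zX] zk; exists z => //; rewrite -zk.
congr (#|` _|); apply/fsetP => y; rewrite !inE /=.
have [->|//] := eqVneq y x; rewrite xX /=.
apply/negP => zx_le; case/eqP: zx; apply: f_inj => //.
by apply/eqP; rewrite eq_le zx_le xmin.
Qed.

(** The sets of each colour [i] are listed by [E i], with a common index type,
    so that the rainbow choices form a finite type. *)
Lemma colorable_indexed (T : set V) (k N : nat) (J : finType)
    (E : 'I_N -> J -> set V) :
  discrete_set T -> (0 < k)%N -> (0 < N)%N -> J ->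
  helly_bound (contains_at_least k T) N ->
  (forall i j, convex_set (E i j)) ->
  (forall phi : {ffun 'I_N -> J},
    contains_at_least k T (\bigcap_(i in [set: 'I_N]) E i (phi i))) ->
  exists i, contains_at_least k T (\bigcap_(j in [set: J]) E i j).
Proof.
move=> dT k_gt0 N_gt0 j0 hellyN cE rainbow.
have /choice [Y YP] : forall phi : {ffun 'I_N -> J}, exists Y : {fset V},
    [set` Y] `<=` (\bigcap_(i in [set: 'I_N]) E i (phi i)) `&` T /\
    (k <= #|` Y|)%N.
  by move=> phi; have /card_le_fsetP[X XE kX] := rainbow phi; exists X.
(* a radius of a ball containing [k] witnesses for every rainbow choice *)
pose r := \sum_phi \sum_(y <- Y phi) `|y|.
pose B := [set x : V | `|x| <= r].
have YB phi : [set` Y phi] `<=` B.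
  move=> y /= yY; rewrite /B /= /r (bigD1 phi)//= (big_fsetD1 y)//= -addrA lerDl.
  by rewrite addr_ge0// sumr_ge0// => psi _; rewrite sumr_ge0.
have finZ : finite_set (T `&` B) := discrete_finite_ball r dT.
pose Z := fset_set (T `&` B).
have ZP x : (x \in Z) <-> T x /\ B x by rewrite in_fset_set// inE.
have [f [cf f_inj]] := exists_generic_functional Z.
pose pts (K : set V) := [fset x in Z | `[< K x >]]%fset.
have ptsP K x : reflect (x \in Z /\ K x) (x \in pts K).
  by rewrite !inE; apply: (iffP andP) => -[xZ /asboolP].
have pts_count K : (k <= #|` pts K|)%N -> contains_at_least k T K.
  move=> kK; apply/card_le_fsetP; exists (pts K) => // x /ptsP[/ZP[Tx _] Kx].
  by split.
have count_pts K : K `<=` B -> contains_at_least k T K -> (k <= #|` pts K|)%N.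
  move=> KB /card_le_fsetP[X XK /leq_trans]; apply; apply: fsubset_leq_card.
  apply/fsubsetP => x xX; have [Kx Tx] := XK x xX.
  by apply/ptsP; split=> //; apply/ZP; split=> //; apply: KB.
(* the intersection of the rainbow choice [s.2] without its colour [s.1] *)
pose S (s : 'I_N * {ffun 'I_N -> J}) :=
  \bigcap_(i in [set i | i != s.1]) E i (s.2 i).
have kS s : (0 < k <= #|` pts (S s)|)%N.
  rewrite k_gt0; have [YE kY] := YP s.2; apply: (leq_trans kY).
  apply: fsubset_leq_card; apply/fsubsetP => x xY; have [Ex Tx] := YE x xY.
  apply/ptsP; split; first by apply/ZP; split=> //; apply: YB xY.
  by move=> i _; apply: Ex.
have /choice [l lk] : forall s, exists l : R,
    #|` [fset x in pts (S s) | l <= f x]%fset| = k.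
  move=> s; have inj_s : {in pts (S s) &, injective f}.
    by move=> x y /ptsP[xZ _] /ptsP[yZ _]; apply: f_inj.
  by have [x _ xk] := kth_largest inj_s (kS s); exists (f x).
pose s0 := (Ordinal N_gt0, [ffun=> j0] : {ffun 'I_N -> J}).
have [s _ smin] := @Order.TotalTheory.arg_minP _ R _ s0 predT l isT.
case: s smin => i0 phi smin.
pose H := [set x : V | l (i0, phi) <= f x].
pose W := [fset x in pts (S (i0, phi)) | l (i0, phi) <= f x]%fset.
exists i0.
suff WE j x : x \in W -> E i0 j x.
  apply/card_le_fsetP; exists W; last by rewrite /W lk.
  move=> x /= xW; split=> [j _|]; first exact: WE.
  by move: xW; rewrite inE /= => /andP[/ptsP[/ZP[]]].
pose psi : {ffun 'I_N -> J} := [ffun i => if i == i0 then j else phi i].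
pose G (m : 'I_N.+1) :=
  B `&` (if unlift ord0 m is Some i then E i (psi i) else H).
have cG m : convex_set (G m).
  apply: convex_setI; first exact: convex_norm_le.
  by case: (unlift ord0 m) => [i|]; [exact: cE|exact: cf].
have GH : G ord0 = B `&` H by rewrite /G unlift_none.
have GE i : G (lift ord0 i) = B `&` E i (psi i) by rewrite /G liftK.
(* each [N] of the [N + 1] sets [G m] miss some index [m]: either a colour, and
   then minimality of the level applies, or the half-space, and then the rest is
   a rainbow choice *)
have /card_le_fsetP [X XG kX] :
    contains_at_least k T (\bigcap_(m in [set: 'I_N.+1]) G m).
  apply: hellyN => // c.
  have [m mc] : exists m, forall i, c i != m.
    apply: contrapT => nm.
    have : (#|'I_N.+1| <= #|'I_N|)%N.
      apply: leq_trans (leq_image_card c 'I_N); apply: subset_leq_card.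
      apply/fintype.subsetP => m _; apply: contrapT => mc; apply: nm; exists m.
      by move=> i; apply: contra_notN mc => /eqP <-; apply: codom_f.
    by rewrite !card_ord ltnn.
  case: (unliftP ord0 m) mc => [i1|] -> mc.
    apply: pts_count; rewrite -(lk (i1, psi)); apply: fsubset_leq_card.
    apply/fsubsetP => y; rewrite inE /= => /andP[/ptsP[yZ Sy] ly].
    apply/ptsP; split=> // i _; have [_ By] := (ZP y).1 yZ.
    have := mc i; case: (unliftP ord0 (c i)) => [i2|] -> ne.
      rewrite GE; split=> //; apply: Sy => /=.
      by apply: contraNneq ne => ->.
    rewrite GH; split=> //; by apply: le_trans ly; apply: smin.
  have [YE kY] := YP psi; apply/card_le_fsetP; exists (Y psi) => // y yY.
  have [Ey Ty] := YE y yY; split=> // i _; have := mc i.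
  case: (unliftP ord0 (c i)) => [i2|] ->; last by rewrite eqxx.
  by rewrite GE => _; split; [apply: YB yY|apply: Ey].
have XW : (X `<=` W)%fset.
  apply/fsubsetP => y yX; have [Gy Ty] := XG y yX.
  have := Gy ord0 I; rewrite GH => -[By Hy].
  rewrite inE /=; apply/andP; split=> //; apply/ptsP; split; first exact/ZP.
  move=> i /= ii0; have := Gy (lift ord0 i) I; rewrite GE => -[_].
  by rewrite ffunE (negPf ii0).
have /eqP -> : W == X by rewrite eq_sym eqEfcard XW lk.
move=> xX; have [Gx _] := XG x xX.
by have := Gx (lift ord0 i0) I; rewrite GE ffunE eqxx => -[].
Qed.

(** Repeating a set of a class is harmless, so all classes can be listed with
    the same number of entries. *)
Lemma colorable_count (T : set V) (k N : nat) :
  discrete_set T -> (0 < k)%N -> (0 < N)%N ->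
  helly_bound (contains_at_least k T) N -> colorable (contains_at_least k T) N.
Proof.
move=> dT k_gt0 N_gt0 hellyN F finF closedF rainbow.
have /choice [s sE] : forall i, exists s : seq (set V), F i = [set` s].
  by move=> i; apply/finite_seqP; have [] := finF i.
pose M := \max_i size (s i).
pose E (i : 'I_N) (j : 'I_M.+1) := nth (head setT (s i)) (s i) j.
have EF i j : F i (E i j).
  rewrite sE /= /E; have [lt|ge] := ltnP j (size (s i)); first exact: mem_nth.
  rewrite nth_default//; have [_ [K]] := finF i; rewrite sE /=.
  by case: (s i) => //= K' s' _; rewrite mem_head.
have [i Ei] : exists i, contains_at_least k T (\bigcap_(j in [set: 'I_M.+1]) E i j).
  apply: colorable_indexed => //; first exact: ord0.
    by move=> i j; have [] := closedF i _ (EF i j).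
  by move=> phi; apply: rainbow.
exists i; apply: contains_at_leastS Ei => x Ex K FK.
have Ks : K \in s i by move: FK; rewrite sE.
have lt : (index K (s i) < M.+1)%N.
  by rewrite ltnS (leq_trans (index_size _ _))// (leq_bigmax i).
by have := Ex (Ordinal lt) I; rewrite /E /= nth_index.
Qed.

End Colorful.

(** * The three properties *)

Section Properties.
Variables (R : realType) (d : nat).
Local Notation V := 'rV[R]_d.

Lemma intersects_count (S : set V) : intersects S = contains_at_least 1 S.
Proof.
apply/funext => K; apply/propext; split=> [[x [Kx Sx]]|/card_le_fsetP [X XK]].
  apply/card_le_fsetP; exists [fset x]%fset; last by rewrite cardfs1.
  by move=> y; rewrite /= inE => /eqP ->.
by rewrite cardfs_gt0 => /fset0Pn [x xX]; exists x; apply: XK.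
Qed.

Lemma helly_number_finite (P : set V -> Prop) : helly_number P <> None ->
  exists2 h, (0 < h)%N & helly_bound P h.
Proof.
by rewrite /helly_number; case: pselect => [[h /asboolP[h0 hP]] _|//]; exists h.
Qed.

(** Two distinct integer points are at distance at least [1], whereas a limit
    point would have two of them at distance less than [1/2]. *)
Lemma integer_lattice_lattice : lattice (integer_lattice R d).
Proof.
have zZ : zmod_closed [in integer_lattice R d].
  split=> [|x y]; rewrite !inE; first by move=> i; rewrite mxE rpred0.
  by move=> Zx Zy i; rewrite !mxE; apply: rpredB; [exact: Zx|exact: Zy].
have le_norm (x : V) i : `|x ord0 i| <= `|x|.
  rewrite [leRHS]/Num.norm /= mx_normrE.
  by apply/bigmax_geP; right; exists (ord0, i).
split=> //; apply/seteqP; split=> // x limx.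
have half0 : 0 < 2^-1 :> R by rewrite invr_gt0.
have [y [yx Zy xy]] := limx _ (nbhsx_ballx x _ half0).
have dxy : 0 < `|x - y| by rewrite normr_gt0 subr_eq0 eq_sym.
have [z [_ Zz xz]] := limx _ (nbhsx_ballx x _ dxy).
rewrite -ball_normE /= in xy xz.
have yz : y = z.
  apply/rowP => i; apply/eqP; rewrite -subr_eq0; apply: contraT => yzi.
  have Zi : y ord0 i - z ord0 i \is a Num.int.
    by apply: rpredB; [exact: Zy|exact: Zz].
  have := norm_intr_ge1 Zi yzi; rewrite leNgt => /negP; case.
  have -> : y ord0 i - z ord0 i = (y - z) ord0 i by rewrite !mxE.
  apply: le_lt_trans (le_norm _ _) _.
  have -> : y - z = (x - z) - (x - y) by apply/rowP => l; rewrite !mxE; ring.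
  by apply: le_lt_trans (ler_normB _ _) _; lra.
by rewrite yz ltxx in xz.
Qed.

End Properties.

Theorem corollary5p4 (R : realType) (d : nat) (P : set 'rV[R]_d -> Prop)
  (HP : [\/ exists S : set 'rV[R]_d,
              [/\ discrete_set S, helly_number (intersects S) <> None
                & P = intersects S],
            exists k : nat,
              (0 < k)%N /\ P = contains_at_least k (integer_lattice R d)
          | exists (k : nat) (Lambda : set 'rV[R]_d)
                   (n : nat) (L : 'I_n -> set 'rV[R]_d),
              [/\ (0 < k)%N, lattice Lambda,
                  forall i, sublattice (L i) Lambda
                & P = contains_at_least k
                        (Lambda `\` \bigcup_(i in [set: 'I_n]) L i)]]) :
  exists N : nat, helly_number P = Some N /\ colorable P N.
Proof.
suff [T [k [h [-> dT k0 h0 hT]]]] : exists T k h,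
    [/\ P = contains_at_least k T, discrete_set T, (0 < k)%N, (0 < h)%N
      & helly_bound (contains_at_least k T) h].
  have [N [PN N0 hN]] := helly_numberP h0 hT.
  by exists N; split=> //; apply: colorable_count.
case: HP => [[S [dS hS ->]]|[k [k0 ->]]|[k [L [n [M [k0 latL subM ->]]]]]].
- have [h h0 hP] := helly_number_finite hS.
  by exists S, 1%N, h; rewrite -intersects_count.
- have zM (i : 'I_0) : zmod_closed [in (set0 : set 'rV[R]_d)] by case: i.
  have [h h0] := helly_bound_lattice_minus k (integer_lattice_lattice R d) zM.
  rewrite bigcup0// setD0 => hZ.
  by exists (integer_lattice R d), k, h; split=> //;
    case: (integer_lattice_lattice R d).
- have [h h0 hP] := helly_bound_lattice_minus k latL (fun i => (subM i).1).
  eexists _, k, h; split; [reflexivity| |by []|by []|exact: hP].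
  apply/seteqP; split=> // x limx; rewrite -latL.2 => U /limx.
  by move=> [y [yx [Ly _] Uy]]; exists y.
Qed.
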